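(* Let $f \in L^\infty([-\pi,\pi])$ have real Fourier coefficients, and suppose there is $\delta>0$ with $\delta \le |f(\theta)|$ for all $\theta\in[-\pi,\pi]$. Let $\widetilde f := f/|f|$. For each $n$: <ul> <li>let $A_n(f)$, $A_n(\widetilde f)$ and $A_M := A_n(|f|)$ be the $n\times n$ Toeplitz matrices generated by $f$, $\widetilde f$ and $|f|$ respectively;</li> <li>let $Y_n$ be the $n\times n$ exchange matrix;</li> <li>define $E_n$ by \[A_M^{-1} Y_n A_n(f) = Y_n A_n(\widetilde f) + E_n.\]</li> </ul> Then $\|E_n\|_2 = o(n)$ as $n\to\infty$. Moreover, for every $n$ all eigenvalues of the symmetric matrix $Y_n A_n(\widetilde f)$ lie in $[-1,1]$.
   Context: For $g\in L^1([-\pi,\pi])$, $A_n(g)$ denotes the $n\times n$ Toeplitz matrix whose $(i,j)$ entry is $\frac{1}{2\pi}\int_{-\pi}^{\pi} g(\theta)e^{-\mathrm{i}(i-j)\theta}\,d\theta$. The exchange matrix $Y_n$ has $(Y_n)_{ij}=1$ if $i+j=n+1$ and $0$ otherwise. $\|\cdot\|_2$ is the spectral norm. *)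

(* Defs.v *)
From HB Require Import structures.
From mathcomp Require Import all_boot all_order all_algebra.
From mathcomp Require Import all_classical all_reals all_analysis.
From mathcomp Require Import complex.
Set Implicit Arguments. Unset Strict Implicit. Unset Printing Implicit Defensive.
Import Order.TTheory GRing.Theory Num.Theory.
Import numFieldNormedType.Exports.
Local Open Scope classical_set_scope.
Local Open Scope ring_scope.

(* A complex-valued function f on [-pi,pi] is represented by its real part
   u and imaginary part v : f = u + i v. *)

Definition Ipi (R : realType) : set R := `[(- pi)%R, pi]%classic.

Definition Rint (R : realType) (g : R -> R) : R :=
  Rintegral (@lebesgue_measure R) (@Ipi R) g.

(* k-th Fourier coefficient (1/2pi) \int f(t) e^{-ikt} dt of f = u + i v:
   (u + iv)(cos kt - i sin kt) = (u cos + v sin) + i (v cos - u sin). *)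
Definition fourier_coef (R : realType) (u v : R -> R) (k : int) : R[i] :=
  Complex ((2 * pi)^-1 * Rint (fun t => u t * cos (k%:~R * t) + v t * sin (k%:~R * t)))
          ((2 * pi)^-1 * Rint (fun t => v t * cos (k%:~R * t) - u t * sin (k%:~R * t))).

Definition toeplitz (R : realType) (u v : R -> R) (n : nat) : 'M[R[i]]_n :=
  \matrix_(i < n, j < n) fourier_coef u v (i%:Z - j%:Z).

(* Exchange matrix: (Y_n)_{ij} = 1 iff i + j = n + 1 (1-indexed),
   i.e. i + j = n - 1 with 0-indexed ordinals. *)
Definition exchange (R : realType) (n : nat) : 'M[R[i]]_n :=
  \matrix_(i < n, j < n) ((i + j)%N == n.-1)%:R.

Definition absf (R : realType) (u v : R -> R) : R -> R :=
  fun t => Num.sqrt (u t ^+ 2 + v t ^+ 2).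
Definition tilde_re (R : realType) (u v : R -> R) : R -> R :=
  fun t => u t / absf u v t.
Definition tilde_im (R : realType) (u v : R -> R) : R -> R :=
  fun t => v t / absf u v t.

Definition vnorm (R : realType) (n : nat) (x : 'cV[R[i]]_n) : R :=
  Num.sqrt (\sum_(i < n) ComplexField.Normc.normc (x i ord0) ^+ 2).
Definition specnorm (R : realType) (n : nat) (A : 'M[R[i]]_n) : R :=
  sup [set vnorm (A *m x) | x in [set x : 'cV[R[i]]_n | vnorm x <= 1]].

Definition Emat (R : realType) (u v : R -> R) (n : nat) : 'M[R[i]]_n :=
  invmx (toeplitz (absf u v) (fun _ => 0) n) *m @exchange R n *m toeplitz u v n
  - @exchange R n *m toeplitz (tilde_re u v) (tilde_im u v) n.

(* Main.v *)
Require Import Defs.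
From HB Require Import structures.
From mathcomp Require Import all_boot all_order all_algebra.
From mathcomp Require Import all_classical all_reals all_analysis.
From mathcomp Require Import complex measurable_realfun ring lra zify.
Set Implicit Arguments. Unset Strict Implicit. Unset Printing Implicit Defensive.
Import Order.TTheory GRing.Theory Num.Theory.
Import numFieldNormedType.Exports.
Local Open Scope classical_set_scope.
Local Open Scope ring_scope.

(** With [P_x(t) = sum_j x_j e^{ijt}] one has
    [y^* A_n(g) x = (1/2pi) \int g conj(P_y) P_x], and [P] is an isometry by
    Parseval.  Hence [|A_n(g)| <= sup |g|] and, for [g >= delta],
    [|A_n(g)^{-1}| <= 1/delta]; as [Y_n] is an isometry, [E_n] is even bounded
    uniformly in [n].

    For the eigenvalues, [Y_n A_n(f~)] is symmetric of norm at most 1, and it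
    remains to see that its entries are real.  Real Fourier coefficients of
    [f = u + i v] mean that the even part of [v] and the odd part of [u] are
    orthogonal to all [cos kt], resp. [sin kt], hence vanish almost everywhere;
    the same then holds for [f/|f|].  This uniqueness is proved on [[0, pi]]: a
    function orthogonal to all [cos kt] is orthogonal to all polynomials in
    [cos t], and the polynomials [(1 - x^n)^(2^n)] of an affine function [x] of
    [cos t] converge to the indicator of [t > a], so all integrals over [(a, pi]]
    vanish and Lebesgue's differentiation theorem applies. *)

(** * Bounded measurable functions *)

(** The bound is pointwise on [D], not essential, so sums, products and restrictions inherit it
    without any null set. *)
Definition bdd_meas (R : realType) (D : set R) (g : R -> R) :=
  measurable_fun D g /\ exists M : R, forall t, D t -> `|g t| <= M.

Lemma bdd_measS (R : realType) (D D' : set R) (g : R -> R) :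
  measurable D -> D' `<=` D -> bdd_meas D g -> bdd_meas D' g.
Proof.
move=> mD DD' [mg [M gM]]; split; first exact: measurable_funS mg.
by exists M => t /DD'; exact: gM.
Qed.

Lemma bdd_meas_cst (R : realType) (D : set R) (c : R) : bdd_meas D (fun=> c).
Proof. by split; [exact: measurable_cst|exists `|c|]. Qed.

Lemma bdd_measD (R : realType) (D : set R) (f g : R -> R) :
  bdd_meas D f -> bdd_meas D g -> bdd_meas D (fun t => f t + g t).
Proof.
move=> [mf [M fM]] [mg [N gN]]; split; first exact: measurable_funD.
by exists (M + N) => t Dt; rewrite (le_trans (ler_normD _ _))// lerD ?fM ?gN.
Qed.

Lemma bdd_measM (R : realType) (D : set R) (f g : R -> R) :
  bdd_meas D f -> bdd_meas D g -> bdd_meas D (fun t => f t * g t).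
Proof.
move=> [mf [M fM]] [mg [N gN]]; split; first exact: measurable_funM.
by exists (M * N) => t Dt; rewrite normrM ler_pM ?fM ?gN.
Qed.

Lemma bdd_measN (R : realType) (D : set R) (f : R -> R) :
  bdd_meas D f -> bdd_meas D (fun t => - f t).
Proof.
move=> [mf [M fM]]; split; first exact: measurableT_comp.
by exists M => t Dt; rewrite normrN fM.
Qed.

Lemma bdd_measB (R : realType) (D : set R) (f g : R -> R) :
  bdd_meas D f -> bdd_meas D g -> bdd_meas D (fun t => f t - g t).
Proof. by move=> bf bg; apply: bdd_measD => //; exact: bdd_measN. Qed.

Lemma bdd_measX (R : realType) (D : set R) (f : R -> R) (n : nat) :
  bdd_meas D f -> bdd_meas D (fun t => f t ^+ n).
Proof.
move=> [mf [M fM]]; split; first exact: measurable_funX.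
by exists (M ^+ n) => t Dt; rewrite normrX lerXn2r ?nnegrE ?fM// (le_trans _ (fM _ Dt)).
Qed.

Lemma bdd_meas_cos (R : realType) (D : set R) (k : R) :
  bdd_meas D (fun t => cos (k * t)).
Proof.
split; last by exists 1 => t _; exact: cos_max.
apply: measurable_funTS; apply: continuous_measurable_fun => x.
by apply: continuous_comp; [apply: mulrl_continuous|apply: continuous_cos].
Qed.

Lemma bdd_meas_sin (R : realType) (D : set R) (k : R) :
  bdd_meas D (fun t => sin (k * t)).
Proof.
split; last by exists 1 => t _; exact: sin_max.
apply: measurable_funTS; apply: continuous_measurable_fun => x.
by apply: continuous_comp; [apply: mulrl_continuous|apply: continuous_sin].
Qed.

Lemma bdd_meas_integrable (R : realType) (i j : itv_bound R) (a b : R) (g : R -> R) :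
  [set` Interval i j] `<=` `[a, b] ->
  bdd_meas [set` Interval i j] g ->
  (@lebesgue_measure R).-integrable [set` Interval i j] (EFin \o g).
Proof.
move=> sub [mg [M gM]]; apply: measurable_bounded_integrable => //.
  apply: (@le_lt_trans _ _ (lebesgue_measure `[a, b]%classic)); first by apply: le_measure => //; rewrite inE.
  by rewrite /= lebesgue_measure_itv/=; case: ifP => // _; rewrite -EFinD ltry.
exists M; split; first exact: num_real.
by move=> N MN t /= Dt; rewrite (le_trans (gM _ Dt))// ltW.
Qed.

Lemma bdd_measNarg (R : realType) (a b : R) (g : R -> R) :
  bdd_meas `[a, b] g -> bdd_meas `[- b, - a] (fun t => g (- t)).
Proof.
move=> [mg [M gM]]; have sub x : `[- b, - a]%classic x -> `[a, b]%classic (- x).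
  by rewrite /= !in_itv/= lerNr lerNl andbC.
split; last by exists M => t /sub; exact: gM.
apply: (measurable_comp (F := `[a, b]%classic)) => //.
by move=> _ [x /sub ? <-].
Qed.

(** Lebesgue measure is its own image under [t -> -t], so this is a change of variables along a
    pushforward. *)
Lemma Rintegral_itvN (R : realType) (a b : R) (g : R -> R) :
  bdd_meas `[a, b] g ->
  Rintegral lebesgue_measure `[a, b] g =
  Rintegral lebesgue_measure `[- b, - a] (fun t => g (- t)).
Proof.
move=> bg.
(* Extension by zero gives a function measurable on the whole line, as the pushforward formula
   asks. *)
pose h := g \_ `[a, b].
have mh : measurable_fun setT h.
  by apply/(measurable_restrictT _ _).1 => //; case: bg.
have E : (-%R : R -> R) @^-1` `[a, b]%classic = `[- b, - a]%classic.
  by apply/seteqP; split => x /=; rewrite !in_itv/= lerNr lerNl andbC.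
have hg x : `[- b, - a]%classic x -> h (- x) = g (- x).
  by rewrite -E => xab; rewrite /h patchE mem_set.
congr fine.
transitivity (\int[lebesgue_measure]_(x in `[a, b]) (h x)%:E)%E.
  by apply: eq_integral => x xab; rewrite /h patchE xab.
transitivity (\int[pushforward lebesgue_measure (-%R : R -> measurableTypeR R)]_(x in `[a, b]) (h x)%:E)%E.
  by apply: eq_measure_integral => //= A mA _; exact/esym/lebesgue_measureN.
rewrite integral_pushforward//=.
- by rewrite E; apply: eq_integral => x /set_mem xab; rewrite /= hg.
- exact/measurable_EFinP.
- rewrite E.
  apply: (@bdd_meas_integrable _ _ _ (- b) (- a) (fun x => h (- x))) => //.
  case: (bdd_measNarg bg) => mgN [M gM]; split.
    by apply: eq_measurable_fun mgN => x /set_mem xab; rewrite hg.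
  by exists M => t tab; rewrite hg// gM.
Qed.

(** * Polynomials approximating a step function *)

Lemma bernoulli_le_expr1B (R : realType) (y : R) (n : nat) :
  0 <= y <= 1 -> 1 - n%:R * y <= (1 - y) ^+ n.
Proof.
move=> /andP[y0 y1]; elim: n => [|n IH]; first by rewrite mul0r subr0 expr0.
rewrite exprS; apply: (@le_trans _ _ ((1 - y) * (1 - n%:R * y))); last first.
  by rewrite ler_wpM2l// subr_ge0.
have : 0 <= n%:R * y ^+ 2 by rewrite mulr_ge0// sqr_ge0.
by rewrite -natr1; nra.
Qed.

Lemma bernoulli_le_expr1D (R : realType) (y : R) (n : nat) :
  0 <= y -> 1 + n%:R * y <= (1 + y) ^+ n.
Proof.
move=> y0; elim: n => [|n IH]; first by rewrite mul0r addr0 expr0.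
rewrite exprS; apply: (@le_trans _ _ ((1 + y) * (1 + n%:R * y))); last first.
  by rewrite ler_wpM2l// addr_ge0.
have : 0 <= n%:R * y ^+ 2 by rewrite mulr_ge0// sqr_ge0.
by rewrite -natr1; nra.
Qed.

(* On [[0, 1]] this converges to 1 for [x < 1/2] and to 0 for [x > 1/2]. *)
Definition step_pow (R : realType) (x : R) (n : nat) : R := (1 - x ^+ n) ^+ (2 ^ n).

Lemma step_pow01 (R : realType) (x : R) (n : nat) :
  0 <= x <= 1 -> 0 <= step_pow x n <= 1.
Proof.
move=> /andP[x0 x1]; have x01 : 0 <= 1 - x ^+ n <= 1.
  by rewrite subr_ge0 exprn_ile1//= gerBl exprn_ge0.
by rewrite /step_pow exprn_ge0 ?exprn_ile1//; case/andP: x01.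
Qed.

(** Bernoulli's inequality gives [1 - (2x)^n <= step_pow x n <= 1], and here [2x < 1]. *)
Lemma step_pow_cvg1 (R : realType) (x : R) :
  0 <= x < 1 / 2 -> step_pow x n @[n --> \oo] --> (1 : R).
Proof.
move=> /andP[x0 x12].
have x01 : 0 <= x <= 1 by rewrite x0/=; lra.
apply: (@squeeze_cvgr _ _ _ _ (fun n => 1 - (2 * x) ^+ n) (fun=> 1)); last first.
- exact: cvg_cst.
- rewrite -[X in _ --> X]subr0; apply: cvgB; first exact: cvg_cst.
  by apply: cvg_expr; rewrite ger0_norm; lra.
- apply: nearW => n; have /andP[_ ->] := step_pow01 n x01; rewrite andbT.
  rewrite exprMn -natrX; apply: bernoulli_le_expr1B.
  by case/andP: x01 => ? ?; rewrite exprn_ge0//= exprn_ile1.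
Qed.

Lemma step_pow_cvg0 (R : realType) (x : R) :
  1 / 2 < x <= 1 -> step_pow x n @[n --> \oo] --> (0 : R).
Proof.
move=> /andP[x12 x1].
have x0 : 0 <= x by lra.
have x01 : 0 <= x <= 1 by rewrite x0/=; lra.
apply: (@squeeze_cvgr _ _ _ _ (fun=> 0) (fun n => (2 * x)^-1 ^+ n)); last first.
- apply: cvg_expr; rewrite ger0_norm ?invr_ge0; last lra.
  by rewrite invf_lt1; lra.
- exact: cvg_cst.
- apply: nearW => n; have /andP[-> _] := step_pow01 n x01 => /=.
  have xn0 : 0 < (2 * x) ^+ n by rewrite exprn_gt0//; lra.
  rewrite exprVn -[leRHS]mul1r ler_pdivlMr//.
  (* [(1 - y)^N (1 + N y) <= ((1 - y) (1 + y))^N <= 1] with [y = x^n], [N = 2^n] *)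
  have H := bernoulli_le_expr1D (2 ^ n) (exprn_ge0 n x0).
  rewrite natrX -exprMn in H.
  have [s0 s1] := andP (step_pow01 n x01).
  apply: (@le_trans _ _ (step_pow x n * (1 + x ^+ n) ^+ (2 ^ n))).
    by rewrite ler_wpM2l// (le_trans _ H)// lerDr.
  rewrite /step_pow -exprMn.
  have -> : (1 - x ^+ n) * (1 + x ^+ n) = 1 - x ^+ n ^+ 2 by ring.
  rewrite exprn_ile1 ?subr_ge0 ?gerBl ?sqr_ge0// -exprM exprn_ile1//.
Qed.

(** * Uniqueness for cosine series on [[0, pi]] *)

(** Frequencies range over [int], so that shifting [k] to [k - 1] needs no special case at 0. *)
Definition cos_null (R : realType) (f : R -> R) :=
  bdd_meas `[0, pi] f /\
  forall k : int, Rintegral lebesgue_measure `[0, pi] (fun t => f t * cos (k%:~R * t)) = 0.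

(** Asking that every null function stay null, rather than that one integral vanish, makes the
    multipliers an algebra. *)
Definition cos_multiplier (R : realType) (m : R -> R) :=
  forall f, cos_null f -> cos_null (fun t => f t * m t).

Lemma itv0pi_integrable (R : realType) (f : R -> R) : bdd_meas `[0, pi] f ->
  (@lebesgue_measure R).-integrable `[0, pi] (EFin \o f).
Proof. by move=> bf; apply: (@bdd_meas_integrable R (BLeft 0) (BRight pi) 0 pi). Qed.

Lemma cos_multiplier_cst (R : realType) (c : R) : cos_multiplier (fun=> c).
Proof.
move=> f [bf f0]; split; first by apply: bdd_measM => //; exact: bdd_meas_cst.
move=> k; under eq_Rintegral do rewrite mulrAC mulrC.
rewrite RintegralZl ?f0 ?mulr0//.
by apply: itv0pi_integrable; apply: bdd_measM => //; exact: bdd_meas_cos.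
Qed.

(** The product formula [2 cos t cos kt = cos (k+1)t + cos (k-1)t] reduces to two integrals that
    vanish. *)
Lemma cos_multiplier_cos (R : realType) : cos_multiplier (@cos R).
Proof.
move=> f [bf f0]; split.
  apply: bdd_measM => //; have := bdd_meas_cos `[0, pi] (1 : R).
  by under [X in bdd_meas _ X]eq_fun do rewrite mul1r.
have bfk (k : int) : bdd_meas `[0, pi] (fun t => f t * cos (k%:~R * t)).
  by apply: bdd_measM => //; exact: bdd_meas_cos.
move=> k.
transitivity (Rintegral lebesgue_measure `[0, pi] (fun t =>
   1 / 2 * (f t * cos ((k + 1)%:~R * t) + f t * cos ((k - 1)%:~R * t)))).
  apply: eq_Rintegral => t _; rewrite rmorphD/= rmorphB/= mulrDl mulrBl !mul1r.
  by rewrite cosB cosD; field.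
rewrite RintegralZl//; last by apply: itv0pi_integrable; exact: bdd_measD.
rewrite RintegralD//; try exact: itv0pi_integrable.
by rewrite !f0 addr0 mulr0.
Qed.

Lemma cos_multiplierD (R : realType) (m1 m2 : R -> R) :
  cos_multiplier m1 -> cos_multiplier m2 -> cos_multiplier (fun t => m1 t + m2 t).
Proof.
move=> h1 h2 f f0; have [b1 i1] := h1 _ f0; have [b2 i2] := h2 _ f0.
have E : (fun t => f t * (m1 t + m2 t)) = (fun t => f t * m1 t + f t * m2 t).
  by apply/funext => t; rewrite mulrDr.
rewrite E; split; first exact: bdd_measD.
move=> k; under eq_Rintegral do rewrite mulrDl.
by rewrite RintegralD ?i1 ?i2 ?addr0//; apply: itv0pi_integrable;
  apply: bdd_measM => //; exact: bdd_meas_cos.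
Qed.

Lemma cos_multiplierM (R : realType) (m1 m2 : R -> R) :
  cos_multiplier m1 -> cos_multiplier m2 -> cos_multiplier (fun t => m1 t * m2 t).
Proof.
move=> h1 h2 f /h1 /h2.
by under [X in cos_null X]eq_fun do rewrite -mulrA.
Qed.

Lemma cos_multiplierX (R : realType) (m : R -> R) (n : nat) :
  cos_multiplier m -> cos_multiplier (fun t => m t ^+ n).
Proof.
move=> hm; elim: n => [|n IH]; first exact: cos_multiplier_cst.
by under [X in cos_multiplier X]eq_fun do rewrite exprS; exact: cos_multiplierM.
Qed.

Lemma cos_null_Rintegral (R : realType) (f : R -> R) :
  cos_null f -> Rintegral lebesgue_measure `[0, pi] f = 0.
Proof.
move=> [_ /(_ 0) f0]; rewrite -[RHS]f0; apply: eq_Rintegral => t _.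
by rewrite mul0r cos0 mulr1.
Qed.

(** For fixed [n] this is a polynomial in [cos t], hence lies in the algebra generated by [cos] and
    the constants. *)
Lemma cos_multiplier_step (R : realType) (c : R) (n : nat) :
  cos_multiplier (fun t => step_pow (1 / 2 + (cos t - c) * (1 / 4)) n).
Proof.
apply: cos_multiplierX; apply: cos_multiplierD; first exact: cos_multiplier_cst.
have -> : (fun t => - (1 / 2 + (cos t - c) * (1 / 4)) ^+ n) =
          (fun t => (1 / 2 + (cos t - c) * (1 / 4)) ^+ n * -1) :> (R -> R).
  by apply/funext => t; rewrite mulrN1.
apply: cos_multiplierM; last exact: cos_multiplier_cst.
apply: cos_multiplierX; apply: cos_multiplierD; first exact: cos_multiplier_cst.
apply: cos_multiplierM; last exact: cos_multiplier_cst.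
by apply: cos_multiplierD; [exact: cos_multiplier_cos|exact: cos_multiplier_cst].
Qed.

(** The cosine decreases on [[0, pi]], so the argument is below 1/2 exactly when [t > a]; the factor
    1/4 keeps it in [[0, 1]]. *)
Lemma step_pow_cos_cvg (R : realType) (a t : R) :
  a \in `[0, pi] -> t \in `[0, pi] -> t != a ->
  step_pow (1 / 2 + (cos t - cos a) * (1 / 4)) n @[n --> \oo] --> ((a < t)%R%:R : R).
Proof.
move=> aJ tJ ta.
have := cos_le1 t; have := cos_le1 a; have := cos_geN1 t; have := cos_geN1 a.
move=> c1 c2 c3 c4.
case: ltgtP ta => // ta _; [apply: step_pow_cvg1|apply: step_pow_cvg0];
  move: ta; rewrite -?(ltr_cos aJ tJ) -?(ltr_cos tJ aJ) => ta; apply/andP; split; lra.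
Qed.

(** The integrals of [f] against the step polynomials all vanish. They converge to the integral over
    []a, pi]] by dominated convergence, with the bound [M] of [f] as dominating constant. *)
Lemma cos_null_tail (R : realType) (f : R -> R) (a : R) :
  cos_null f -> a \in `[0, pi] -> Rintegral lebesgue_measure `]a, pi] f = 0.
Proof.
move=> f0 aJ; have [[mf [M fM]] _] := f0.
have E : `]a, pi]%classic = `[0, pi] `&` `]a, pi] :> set R.
  apply/seteqP; split => t /=; rewrite !in_itv/=; last by case.
  move: aJ; rewrite in_itv/= => /andP[a0 _] /andP[at_ tpi].
  by rewrite at_ tpi (le_trans a0 (ltW at_)).
rewrite {}E Rintegral_mkcondr.
pose x t : R := 1 / 2 + (cos t - cos a) * (1 / 4).
pose f_ n (t : R) : \bar R := (f t * step_pow (x t) n)%:E.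
have [| | | | | |_ _ cvgf] := @dominated_convergence _ _ R lebesgue_measure `[0, pi]%classic
  _ f_ (fun t => ((f \_ `]a, pi]) t)%:E) (fun=> M%:E).
- by [].
- move=> n; apply/measurable_EFinP.
  by have [[]] := cos_multiplier_step (cos a) n f0.
- apply/measurable_EFinP/measurable_restrict => //.
  by apply: measurable_funS mf => //; exact: subIsetl.
(* At [t = a] the argument is 1/2, where no limit is claimed; this single point is null. *)
- exists [set a]; split; [by []|exact: lebesgue_measure_set1|].
  move=> t /= /not_implyP[tJ nt]; apply: contrapT => /eqP ta; apply: nt.
  apply: cvg_EFin; first by apply: nearW.
  rewrite patchE.
  have -> : (if t \in `]a, pi]%classic then f t else point) = f t * (a < t)%R%:R.
    rewrite mem_setE in_itv/=; move: tJ; rewrite in_itv/= => /andP[_ ->].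
    by rewrite andbT; case: ifP => _; rewrite (mulr1, mulr0).
  by apply: cvgM; [exact: cvg_cst|exact: step_pow_cos_cvg].
- exact: (itv0pi_integrable (bdd_meas_cst _ M)).
- apply: aeW => t n tJ; rewrite lee_fin normrM.
  have /andP[s0 s1] : 0 <= step_pow (x t) n <= 1.
    apply: step_pow01; rewrite /x.
    have := cos_le1 t; have := cos_le1 a; have := cos_geN1 t; have := cos_geN1 a.
    by move=> *; lra.
  rewrite (ger0_norm s0) -[leRHS]mulr1 ler_pM// fM//.
- have F n : (\int[lebesgue_measure]_(t in `[0%R, pi]) f_ n t = 0)%E.
    have := cos_null_Rintegral (cos_multiplier_step (cos a) n f0).
    (* [fine] sends infinite values to 0 as well, so finiteness of the integral is needed to recover
       its extended value. *)
    rewrite /Rintegral => /eqP; rewrite fine_eq0 => [/eqP//|].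
    apply: integrable_fin_num => //; apply: itv0pi_integrable.
    by have [] := cos_multiplier_step (cos a) n f0.
  move: cvgf; under eq_fun do rewrite F.
  move=> /cvg_lim; rewrite lim_cst// /Rintegral => <- //.
Qed.

(** The primitive of [f] from 0 is the total integral minus a tail, hence zero on [[0, pi]]; by
    Lebesgue differentiation its derivative is [f] almost everywhere. *)
Lemma cos_null_ae0 (R : realType) (f : R -> R) : cos_null f ->
  {ae lebesgue_measure, forall t, `[0, pi]%classic t -> f t = 0}.
Proof.
move=> f0; have [bf _] := f0; have fi := itv0pi_integrable bf.
(* The differentiation theorem is applied to a function locally integrable on the whole line. *)
pose g := f \_ `[0, pi].
have gi : (@lebesgue_measure R).-integrable setT (EFin \o g).
  by rewrite /g -restrict_EFin; apply/integrable_restrict => //=; rewrite setTI.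
have locg : locally_integrable setT g by exact: integrable_locally.
have giy (y : R) : (@lebesgue_measure R).-integrable `[0, y] (EFin \o g).
  exact: integrableS gi.
have := FTC1 giy locg.
set F := (fun x : R => _) => FTC.
have F0 x : x \in `[0, pi] -> F x = 0.
  move=> xJ; rewrite /F.
  transitivity (Rintegral lebesgue_measure `[0, x] f).
    apply: eq_Rintegral => t; rewrite mem_setE in_itv/= => /andP[t0 tx].
    rewrite /g patchE mem_set//= in_itv/= t0/=.
    by move: xJ; rewrite in_itv/= => /andP[_ ]; exact: le_trans.
  have := @Rintegral_itvB R f (BLeft 0) (BRight pi) x fi.
  rewrite !bnd_simp !(itvP xJ) => /(_ isT isT).
  by rewrite cos_null_tail// cos_null_Rintegral// sub0r => /eqP; rewrite oppr_eq0 => /eqP.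
(* The endpoints are discarded, since the derivative at [t] is computed from a neighbourhood on
   which [F] is zero. *)
have ae0 : {ae lebesgue_measure, forall t : R, t != 0}.
  exists [set 0]; split; [by []|exact: lebesgue_measure_set1|].
  by move=> t /= /negP; rewrite negbK => /eqP.
have aepi : {ae lebesgue_measure, forall t : R, t != pi}.
  exists [set pi]; split; [by []|exact: lebesgue_measure_set1|].
  by move=> t /= /negP; rewrite negbK => /eqP.
move: FTC ae0 aepi; apply: filterS3.
  exact: (ae_filter_ringOfSetsType lebesgue_measure).
move=> t FTC t0 tpi /=; rewrite in_itv/= => /andP[t0' tpi'].
have {}t0 : 0 < t by rewrite lt_neqAle eq_sym t0.
have {}tpi : t < pi by rewrite lt_neqAle tpi.
have [_ dF] := FTC t0.
have -> : f t = g t by rewrite /g patchE mem_set//= in_itv/= t0' tpi'.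
rewrite -dF derive1E (@near_eq_derive _ _ _ _ (cst 0)) ?derive_cst//.
have : \forall z \near t, z \in `]0, pi[%R by apply: near_in_itvoo; rewrite in_itv/= t0.
by apply: filterS => z z0; rewrite F0//; exact: subset_itv_oo_cc.
Qed.

(** * Symmetry of symbols with real Fourier coefficients *)

Lemma measurable_Ipi (R : realType) : measurable (@Ipi R).
Proof. exact: measurable_itv. Qed.

Lemma Rint_fold (R : realType) (h : R -> R) : bdd_meas (@Ipi R) h ->
  Defs.Rint h = Rintegral lebesgue_measure `[0, pi] (fun t => h t + h (- t)).
Proof.
move=> bh; have pi0 := pi_ge0 R.
have hi : (@lebesgue_measure R).-integrable (@Ipi R) (EFin \o h).
  by apply: (@bdd_meas_integrable R (BLeft (- pi)) (BRight pi) (- pi) pi).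
have sp : `[0, pi]%classic `<=` @Ipi R.
  by move=> t; rewrite /Ipi/= !in_itv/= => /andP[t0 ->]; rewrite andbT (le_trans _ t0)// oppr_le0.
have sn : `[- pi, 0]%classic `<=` @Ipi R.
  by move=> t; rewrite /Ipi/= !in_itv/= => /andP[-> t0]/=; rewrite (le_trans t0).
have bp : bdd_meas `[0, pi] h.
  by apply: (bdd_measS (@measurable_Ipi R) _ bh).
have bn : bdd_meas `[- pi, 0] h.
  by apply: (bdd_measS (@measurable_Ipi R) _ bh).
have bn' : bdd_meas `[0, pi] (fun t => h (- t)).
  by have := bdd_measNarg bn; rewrite oppr0 opprK.
rewrite RintegralD//; [|exact: itv0pi_integrable bp|exact: itv0pi_integrable bn'].
have := Rintegral_itvN bn; rewrite oppr0 opprK => <-.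
have := @Rintegral_itvB R h (BLeft (- pi)) (BRight pi) 0 hi.
rewrite !bnd_simp oppr_le0 pi0 => /(_ isT isT).
(* Cutting at 0 leaves []0, pi]]; closing the interval adds a null point. *)
rewrite Rintegral_itv_obnd_cbnd; last first.
  by apply: integrableS (itv0pi_integrable bp) => //; exact: subset_itv_oc_cc.
by rewrite /Defs.Rint /Ipi => /eqP; rewrite subr_eq => /eqP.
Qed.

(** With [w = v + v(-t)] and [z = u - u(-t)], folding the hypothesis onto [[0, pi]] equates the
    cosine integrals of [w] with the sine integrals of [z]. Both families vanish by parity in [k],
    and cosine uniqueness applies to [w] and to [z sin t]. *)
Lemma real_coef_symmetry (R : realType) (u v : R -> R) :
  bdd_meas (@Ipi R) u -> bdd_meas (@Ipi R) v ->
  (forall k : int, Defs.Rint (fun t => v t * cos (k%:~R * t) - u t * sin (k%:~R * t)) = 0) ->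
  {ae lebesgue_measure, forall t, `[0, pi]%classic t -> v (- t) = - v t /\ u (- t) = u t}.
Proof.
move=> bu bv coef0; have pi0 := pi_ge0 R.
have sp : `[0, pi]%classic `<=` @Ipi R.
  by move=> t; rewrite /Ipi/= !in_itv/= => /andP[t0 ->]; rewrite andbT (le_trans _ t0)// oppr_le0.
have fold_bdd (g : R -> R) : bdd_meas (@Ipi R) g -> bdd_meas `[0, pi] (fun t => g (- t)).
  move=> bg; apply: (@bdd_measS R `[- pi, - - pi]); [by []| |exact: bdd_measNarg].
  by rewrite opprK.
have [bu1 bu2] : bdd_meas `[0, pi] u /\ bdd_meas `[0, pi] (fun t => u (- t)).
  by split; [by apply: (bdd_measS (@measurable_Ipi R) _ bu)|exact: fold_bdd].
have [bv1 bv2] : bdd_meas `[0, pi] v /\ bdd_meas `[0, pi] (fun t => v (- t)).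
  by split; [by apply: (bdd_measS (@measurable_Ipi R) _ bv)|exact: fold_bdd].
pose w t := v t + v (- t); pose z t := u t - u (- t).
have bw : bdd_meas `[0, pi] w by exact: bdd_measD.
have bz : bdd_meas `[0, pi] z by exact: bdd_measB.
have bwc (k : int) : bdd_meas `[0, pi] (fun t => w t * cos (k%:~R * t)).
  by apply: bdd_measM => //; exact: bdd_meas_cos.
have bzs (k : int) : bdd_meas `[0, pi] (fun t => z t * sin (k%:~R * t)).
  by apply: bdd_measM => //; exact: bdd_meas_sin.
have wz (k : int) : Rintegral lebesgue_measure `[0, pi] (fun t => w t * cos (k%:~R * t))
  = Rintegral lebesgue_measure `[0, pi] (fun t => z t * sin (k%:~R * t)).
  apply/eqP; rewrite -subr_eq0 -RintegralB//; try exact: itv0pi_integrable.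
  rewrite -[X in _ == X](coef0 k) Rint_fold; last first.
    by apply: bdd_measB; apply: bdd_measM => //; [exact: bdd_meas_cos|exact: bdd_meas_sin].
  apply/eqP; apply: eq_Rintegral => t _.
  by rewrite mulrN cosN sinN /w /z; ring.
(* The cosine side is even in [k] and the sine side is odd, so comparing [k] with [-k] makes both
   zero. *)
have zs0 (k : int) : Rintegral lebesgue_measure `[0, pi] (fun t => z t * sin (k%:~R * t)) = 0.
  have := wz (- k).
  under eq_Rintegral do rewrite rmorphN/= mulNr cosN.
  rewrite wz.
  under [in X in _ = X -> _]eq_Rintegral do rewrite rmorphN/= mulNr sinN mulrN -mulN1r.
  by rewrite RintegralZl//; [lra|exact: itv0pi_integrable].
have wae : cos_null w by split => // k; rewrite wz zs0.
(* The factor [sin t] turns sine orthogonality into cosine orthogonality, by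
   [2 sin t cos kt = sin (k+1)t - sin (k-1)t]; it is positive inside []0, pi[] and can be cancelled
   at the end. *)
have zae : cos_null (fun t => z t * sin t).
  split.
    by have := bzs 1; under [X in bdd_meas _ X]eq_fun do rewrite mul1r.
  move=> k; transitivity (Rintegral lebesgue_measure `[0, pi] (fun t =>
     1 / 2 * (z t * sin ((k + 1)%:~R * t) - z t * sin ((k - 1)%:~R * t)))).
    apply: eq_Rintegral => t _; move: (z t) => y; rewrite rmorphD/= rmorphB/= mulrDl mulrBl !mul1r.
    by rewrite sinB sinD; field.
  rewrite RintegralZl//; last by apply: itv0pi_integrable; exact: bdd_measB.
  rewrite RintegralB//; try exact: itv0pi_integrable.
  by rewrite !zs0 subr0 mulr0.
have ae0 : {ae lebesgue_measure, forall t : R, t != 0 /\ t != pi}.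
  exists [set 0; pi]; split.
  - by apply: measurableU; exact: measurable_set1.
  - by apply: countable_lebesgue_measure0; exact: finite_set_countable.
  - by move=> t /= /not_andP[|] /negP; rewrite negbK => /eqP; [left|right].
move: (cos_null_ae0 wae) (cos_null_ae0 zae) ae0; apply: filterS3.
  exact: (ae_filter_ringOfSetsType lebesgue_measure).
move=> t wt zt [t0 tpi] tJ; move: (wt tJ) (zt tJ); rewrite /w /z => {}wt /eqP.
rewrite mulf_eq0 => /orP[|]; last first.
  move: tJ; rewrite /= in_itv/= => /andP[t0' tpi'].
  by rewrite gt_eqF// sin_gt0_pi// !lt_neqAle eq_sym t0 tpi t0'.
rewrite subr_eq0 => /eqP ->; split=> //.
by apply/eqP; rewrite -addr_eq0 addrC wt.
Qed.

(** * Modulus, normalised symbol and changes on null sets *)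

Lemma ae_eq_Rintegral (R : realType) (D : set R) (f g : R -> R) :
  measurable D -> measurable_fun D f -> measurable_fun D g ->
  {ae lebesgue_measure, forall t, D t -> f t = g t} ->
  Rintegral lebesgue_measure D f = Rintegral lebesgue_measure D g.
Proof.
move=> mD mf mg fg; congr fine; apply: ae_eq_integral => //; try exact/measurable_EFinP.
move: fg; apply: filterS; first exact: (ae_filter_ringOfSetsType lebesgue_measure).
by move=> t fg Dt /=; rewrite fg.
Qed.

Lemma measurable_absf (R : realType) (D : set R) (u v : R -> R) :
  measurable_fun D u -> measurable_fun D v -> measurable_fun D (absf u v).
Proof.
move=> mu mv; apply: (measurable_comp (F := setT)) => //.
  by apply: continuous_measurable_fun; exact: sqrt_continuous.
by apply: measurable_funD; apply: measurable_funX.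
Qed.

Lemma absf_ge0 (R : realType) (u v : R -> R) (t : R) : 0 <= absf u v t.
Proof. exact: sqrtr_ge0. Qed.

Lemma sqr_absf (R : realType) (u v : R -> R) (t : R) :
  absf u v t ^+ 2 = u t ^+ 2 + v t ^+ 2.
Proof. by rewrite sqr_sqrtr// addr_ge0// sqr_ge0. Qed.

Lemma absf_tilde (R : realType) (u v : R -> R) (t : R) :
  0 < absf u v t -> absf (tilde_re u v) (tilde_im u v) t = 1.
Proof.
move=> a0; rewrite /absf /tilde_re /tilde_im !expr_div_n -mulrDl -sqr_absf.
by rewrite divff ?sqrtr1// expf_neq0// gt_eqF.
Qed.

Lemma le_norm_absf (R : realType) (u v : R -> R) (t : R) :
  `|u t| <= absf u v t /\ `|v t| <= absf u v t.
Proof.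
split; rewrite -(@ler_pXn2r _ 2)// ?nnegrE ?absf_ge0// real_normK ?num_real//.
  by rewrite sqr_absf lerDl sqr_ge0.
by rewrite sqr_absf lerDr sqr_ge0.
Qed.

Lemma bdd_meas_symbol (R : realType) (D : set R) (u v : R -> R) (M : R) :
  measurable_fun D u -> measurable_fun D v -> (forall t, D t -> absf u v t <= M) ->
  bdd_meas D u /\ bdd_meas D v.
Proof.
move=> mu mv uvM; split; split=> //; exists M => t /uvM; apply: le_trans.
  exact: (le_norm_absf u v t).1.
exact: (le_norm_absf u v t).2.
Qed.

(** Inversion is continuous on []0, +oo[], and the modulus takes its values there. *)
Lemma measurable_div_absf (R : realType) (D : set R) (u v w : R -> R) :
  measurable D ->
  measurable_fun D u -> measurable_fun D v -> measurable_fun D w ->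
  (forall t, D t -> 0 < absf u v t) ->
  measurable_fun D (fun t => w t / absf u v t).
Proof.
move=> mD mu mv mw uv0; apply: measurable_funM => //.
have -> : (fun t => (absf u v t)^-1) = (@GRing.inv R) \o absf u v by [].
apply: (@measurable_comp _ _ _ _ _ _ (`]0, +oo[%classic : set R)); last exact: measurable_absf.
- exact: measurable_itv.
- by move=> _ [t Dt <-] /=; rewrite in_itv/= uv0.
apply: open_continuous_measurable_fun => [|x]; first exact: interval_open.
by rewrite mem_setE in_itv/= andbT => x0; apply: inv_continuous; rewrite gt_eqF.
Qed.

Lemma fourier_coef_ae_eq (R : realType) (u v u' v' : R -> R) :
  measurable_fun (@Ipi R) u -> measurable_fun (@Ipi R) v ->
  measurable_fun (@Ipi R) u' -> measurable_fun (@Ipi R) v' ->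
  {ae lebesgue_measure, forall t, @Ipi R t -> u t = u' t /\ v t = v' t} ->
  (forall k : int, fourier_coef u v k = fourier_coef u' v' k).
Proof.
move=> mu mv mu' mv' uv k.
have mc (w : R -> R) : measurable_fun (@Ipi R) w ->
    measurable_fun (@Ipi R) (fun t => w t * cos (k%:~R * t)).
  by move=> mw; apply: measurable_funM => //; case: (bdd_meas_cos (@Ipi R) (k%:~R : R)).
have ms (w : R -> R) : measurable_fun (@Ipi R) w ->
    measurable_fun (@Ipi R) (fun t => w t * sin (k%:~R * t)).
  by move=> mw; apply: measurable_funM => //; case: (bdd_meas_sin (@Ipi R) (k%:~R : R)).
have mI := @measurable_Ipi R.
rewrite /fourier_coef /Defs.Rint; congr (Complex (_ * _) (_ * _)); apply: ae_eq_Rintegral => //.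
- by apply: measurable_funD; [exact: mc|exact: ms].
- by apply: measurable_funD; [exact: mc|exact: ms].
- move: uv; apply: filterS; first exact: (ae_filter_ringOfSetsType lebesgue_measure).
  by move=> t uv It; have [-> ->] := uv It.
- by apply: measurable_funB; [exact: mc|exact: ms].
- by apply: measurable_funB; [exact: mc|exact: ms].
- move: uv; apply: filterS; first exact: (ae_filter_ringOfSetsType lebesgue_measure).
  by move=> t uv It; have [-> ->] := uv It.
Qed.

(** The symbol is bounded only almost everywhere, whereas the operator estimates use pointwise
    bounds. A change on a null set repairs this and preserves the lower bound [delta]. *)
Lemma ae_bounded_symbol (R : realType) (u v : R -> R) (delta : R) :
  measurable_fun (@Ipi R) u -> measurable_fun (@Ipi R) v ->
  (exists M : R, {ae lebesgue_measure, forall t, @Ipi R t -> absf u v t <= M}) ->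
  0 < delta -> (forall t, @Ipi R t -> delta <= absf u v t) ->
  exists u' v' : R -> R, exists M : R,
    [/\ measurable_fun (@Ipi R) u' /\ measurable_fun (@Ipi R) v',
        {ae lebesgue_measure, forall t, @Ipi R t -> u t = u' t /\ v t = v' t} &
        0 < M /\ forall t, @Ipi R t -> delta <= absf u' v' t <= M].
Proof.
move=> mu mv [M0 [N [mN N0 uvN]]] d0 duv.
(* On the exceptional null set the symbol is replaced by a constant [M >= delta]. *)
pose M := `|M0| + delta.
have M_gt0 : 0 < M by rewrite ltr_wpDl.
exists (fun t => u t * \1_(~` N) t + M * \1_N t), (fun t => v t * \1_(~` N) t), M.
have mN1 : measurable_fun (@Ipi R) (\1_N : R -> R).
  exact/measurable_funTS/measurable_indic.
have mN2 : measurable_fun (@Ipi R) (\1_(~` N) : R -> R).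
  by apply/measurable_funTS/measurable_indic; exact: measurableC.
split.
- split; last exact: measurable_funM.
  by apply: measurable_funD; apply: measurable_funM => //; exact: measurable_cst.
- exists N; split=> //; apply: subsetCl => t /= Nt It.
  by rewrite !indicE (memNset Nt) mem_set//= !mulr1 mulr0 addr0.
- split=> // t It; rewrite /absf !indicE in_setC; case: (boolP (t \in N)) => /= tN.
    rewrite !mulr0 add0r mulr1 expr0n/= addr0 sqrtr_sqr gtr0_norm// lexx andbT.
    by rewrite /M lerDr.
  rewrite !mulr1 mulr0 addr0 -/(absf u v t) duv//=.
  apply: (@le_trans _ _ M0); last by rewrite /M (le_trans (ler_norm _))// lerDl ltW.
  have : ~ N t by move: tN => /negP; rewrite inE.
  by apply: contra_notP => tM; apply: uvN => /= /(_ It).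
Qed.

(** Almost everywhere [u] is even and [v] odd, so [|f|] is even and the quotients inherit the
    symmetry; the folded integrand is then zero. *)
Lemma tilde_real_coef (R : realType) (u v : R -> R) (delta M : R) (k : int) :
  measurable_fun (@Ipi R) u -> measurable_fun (@Ipi R) v ->
  0 < delta -> (forall t, @Ipi R t -> delta <= absf u v t <= M) ->
  (forall k : int, complex.Im (fourier_coef u v k) = 0) ->
  complex.Im (fourier_coef (tilde_re u v) (tilde_im u v) k) = 0.
Proof.
move=> mu mv d0 uvb coef0; have mI := @measurable_Ipi R.
have uvM t : @Ipi R t -> absf u v t <= M by move=> /uvb /andP[].
have uv0 t : @Ipi R t -> 0 < absf u v t.
  by move=> /uvb /andP[+ _]; exact: lt_le_trans.
have [bu bv] := bdd_meas_symbol mu mv uvM.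
have [bu' bv'] : bdd_meas (@Ipi R) (tilde_re u v) /\ bdd_meas (@Ipi R) (tilde_im u v).
  apply: (@bdd_meas_symbol _ _ _ _ 1).
  - exact: measurable_div_absf.
  - exact: measurable_div_absf.
  - by move=> t It; rewrite absf_tilde// uv0.
have symm : {ae lebesgue_measure, forall t, `[0, pi]%classic t -> v (- t) = - v t /\ u (- t) = u t}.
  apply: real_coef_symmetry => // j; have := coef0 j; rewrite /fourier_coef/=.
  move/eqP; rewrite mulf_eq0 invr_eq0 mulf_eq0 pnatr_eq0/= gt_eqF ?pi_gt0//=.
  by move/eqP.
have bh : bdd_meas (@Ipi R) (fun t => tilde_im u v t * cos (k%:~R * t) - tilde_re u v t * sin (k%:~R * t)).
  by apply: bdd_measB; apply: bdd_measM => //; [exact: bdd_meas_cos|exact: bdd_meas_sin].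
rewrite /fourier_coef /= Rint_fold//.
have -> : Rintegral lebesgue_measure `[0, pi] (fun t : R =>
    tilde_im u v t * cos (k%:~R * t) - tilde_re u v t * sin (k%:~R * t) +
    (tilde_im u v (- t) * cos (k%:~R * - t) - tilde_re u v (- t) * sin (k%:~R * - t))) =
    Rintegral lebesgue_measure `[0, pi] (fun=> 0).
  apply: ae_eq_Rintegral => //.
    apply: (bdd_measD _ _).1; last first.
      have := bdd_measNarg bh; rewrite opprK => bh'.
      apply: (bdd_measS _ _ bh') => // t /=; rewrite !in_itv/= => /andP[t0 ->].
      by rewrite andbT (le_trans _ t0)// oppr_le0 pi_ge0.
    apply: (bdd_measS mI _ bh) => t; rewrite /Ipi/= !in_itv/= => /andP[t0 ->].
    by rewrite andbT (le_trans _ t0)// oppr_le0 pi_ge0.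
  move: symm; apply: filterS; first exact: (ae_filter_ringOfSetsType lebesgue_measure).
  move=> t symm tJ; have [vt ut] := symm tJ.
  have at_ : absf u v (- t) = absf u v t by rewrite /absf vt ut sqrrN.
  by rewrite /tilde_re /tilde_im at_ vt ut mulrN cosN sinN; ring.
by rewrite Rintegral_cst// mul0r mulr0.
Qed.

(** * Toeplitz quadratic forms *)

Local Open Scope complex_scope.

Definition cint (R : realType) (h : R -> R[i]) : R[i] :=
  Complex (Defs.Rint (fun t => complex.Re (h t))) (Defs.Rint (fun t => complex.Im (h t))).

Definition cbdd (R : realType) (h : R -> R[i]) : Prop :=
  bdd_meas (@Ipi R) (fun t => complex.Re (h t)) /\ bdd_meas (@Ipi R) (fun t => complex.Im (h t)).

Lemma ReM (R : rcfType) (x y : R[i]) :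
  complex.Re (x * y) = complex.Re x * complex.Re y - complex.Im x * complex.Im y.
Proof. by case: x y => [a b] [c d]. Qed.
Lemma ImM (R : rcfType) (x y : R[i]) :
  complex.Im (x * y) = complex.Re x * complex.Im y + complex.Im x * complex.Re y.
Proof. by case: x y => [a b] [c d]. Qed.
Lemma ReD (R : rcfType) (x y : R[i]) : complex.Re (x + y) = complex.Re x + complex.Re y.
Proof. by case: x y => [a b] [c d]. Qed.
Lemma ImD (R : rcfType) (x y : R[i]) : complex.Im (x + y) = complex.Im x + complex.Im y.
Proof. by case: x y => [a b] [c d]. Qed.
Lemma ReJ (R : rcfType) (x : R[i]) : complex.Re x^* = complex.Re x.
Proof. by case: x. Qed.
Lemma ImJ (R : rcfType) (x : R[i]) : complex.Im x^* = - complex.Im x.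
Proof. by case: x. Qed.
Lemma complex_ext (R : rcfType) (x y : R[i]) :
  complex.Re x = complex.Re y -> complex.Im x = complex.Im y -> x = y.
Proof. by case: x y => [a b] [c d] /= -> ->. Qed.

Lemma Ipi_integrable (R : realType) (f : R -> R) : bdd_meas (@Ipi R) f ->
  (@lebesgue_measure R).-integrable (@Ipi R) (EFin \o f).
Proof. by move=> bf; apply: (@bdd_meas_integrable R (BLeft (- pi)) (BRight pi) (- pi) pi). Qed.

Lemma RintZl (R : realType) (c : R) (f : R -> R) : bdd_meas (@Ipi R) f ->
  Defs.Rint (fun t => c * f t) = c * Defs.Rint f.
Proof.
by move=> bf; apply: RintegralZl; [exact: measurable_Ipi|exact: Ipi_integrable].
Qed.

Lemma RintD (R : realType) (f g : R -> R) : bdd_meas (@Ipi R) f -> bdd_meas (@Ipi R) g ->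
  Defs.Rint (fun t => f t + g t) = Defs.Rint f + Defs.Rint g.
Proof.
by move=> bf bg; apply: RintegralD; [exact: measurable_Ipi|exact: Ipi_integrable..].
Qed.

Lemma RintB (R : realType) (f g : R -> R) : bdd_meas (@Ipi R) f -> bdd_meas (@Ipi R) g ->
  Defs.Rint (fun t => f t - g t) = Defs.Rint f - Defs.Rint g.
Proof.
by move=> bf bg; apply: RintegralB; [exact: measurable_Ipi|exact: Ipi_integrable..].
Qed.

Lemma le_Rint (R : realType) (f g : R -> R) :
  bdd_meas (@Ipi R) f -> bdd_meas (@Ipi R) g ->
  (forall t, @Ipi R t -> f t <= g t) -> Defs.Rint f <= Defs.Rint g.
Proof.
move=> bf bg fg; rewrite /Defs.Rint; apply: le_Rintegral => //;
  [exact: measurable_Ipi|exact: Ipi_integrable..].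
Qed.

Lemma cbdd_cst (R : realType) (c : R[i]) : cbdd (fun _ : R => c).
Proof. by split; exact: bdd_meas_cst. Qed.

Lemma cbddD (R : realType) (f g : R -> R[i]) :
  cbdd f -> cbdd g -> cbdd (fun t => f t + g t).
Proof.
move=> [f1 f2] [g1 g2]; split.
  by under eq_fun do rewrite ReD; exact: bdd_measD.
by under eq_fun do rewrite ImD; exact: bdd_measD.
Qed.

Lemma cbddM (R : realType) (f g : R -> R[i]) :
  cbdd f -> cbdd g -> cbdd (fun t => f t * g t).
Proof.
move=> [f1 f2] [g1 g2]; split.
  by under eq_fun do rewrite ReM; apply: bdd_measB; exact: bdd_measM.
by under eq_fun do rewrite ImM; apply: bdd_measD; exact: bdd_measM.
Qed.

Lemma cbddJ (R : realType) (f : R -> R[i]) : cbdd f -> cbdd (fun t => (f t)^*).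
Proof.
move=> [f1 f2]; split; first by under eq_fun do rewrite ReJ.
by under eq_fun do rewrite ImJ; exact: bdd_measN.
Qed.

Lemma cbdd_sum (R : realType) (I : Type) (r : seq I) (F : I -> R -> R[i]) :
  (forall i, cbdd (F i)) -> cbdd (fun t => \sum_(i <- r) F i t).
Proof.
move=> bF; elim: r => [|i r IH].
  by under eq_fun do rewrite big_nil; exact: cbdd_cst.
by under eq_fun do rewrite big_cons; exact: cbddD.
Qed.

Lemma cintD (R : realType) (f g : R -> R[i]) :
  cbdd f -> cbdd g -> cint (fun t => f t + g t) = cint f + cint g.
Proof.
move=> [f1 f2] [g1 g2]; apply: complex_ext => /=; rewrite -RintD//; congr Defs.Rint;
  by apply/funext => t; rewrite (ReD, ImD).
Qed.

Lemma cintZl (R : realType) (c : R[i]) (f : R -> R[i]) :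
  cbdd f -> cint (fun t => c * f t) = c * cint f.
Proof.
move=> [f1 f2]; apply: complex_ext.
  rewrite ReM /= -!RintZl// -RintB//; first by congr Defs.Rint; apply/funext => t; rewrite ReM.
  - by apply: bdd_measM => //; exact: bdd_meas_cst.
  - by apply: bdd_measM => //; exact: bdd_meas_cst.
rewrite ImM /= -!RintZl// -RintD//; first by congr Defs.Rint; apply/funext => t; rewrite ImM.
- by apply: bdd_measM => //; exact: bdd_meas_cst.
- by apply: bdd_measM => //; exact: bdd_meas_cst.
Qed.

Lemma cint_sum (R : realType) (I : Type) (r : seq I) (F : I -> R -> R[i]) :
  (forall i, cbdd (F i)) -> cint (fun t => \sum_(i <- r) F i t) = \sum_(i <- r) cint (F i).
Proof.
move=> bF; elim: r => [|i r IH].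
  under [X in cint X]eq_fun do rewrite big_nil.
  rewrite big_nil /cint/= /Defs.Rint Rintegral_cst ?mul0r//; exact: measurable_Ipi.
under [X in cint X]eq_fun do rewrite big_cons.
by rewrite big_cons cintD// ?IH//; exact: cbdd_sum.
Qed.

(** * Trigonometric polynomials and Parseval's identity *)

Definition cis (R : realType) (t : R) : R[i] := cos t +i* sin t.

Definition trigpoly (R : realType) (n : nat) (x : 'cV[R[i]]_n) (t : R) : R[i] :=
  \sum_(j < n) x j ord0 * cis (j%:R * t).

Lemma cbdd_cis (R : realType) (k : R) : cbdd (fun t => cis (k * t)).
Proof. by split; [exact: bdd_meas_cos|exact: bdd_meas_sin]. Qed.

Lemma cbdd_trigpoly (R : realType) (n : nat) (x : 'cV[R[i]]_n) : cbdd (trigpoly x).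
Proof.
by apply: cbdd_sum => j; apply: cbddM; [exact: cbdd_cst|exact: cbdd_cis].
Qed.

(** Splitting the exponential of [i - j] into a factor for the row and one for the column lets the
    double sum of a quadratic form factor. *)
Lemma fourier_coef_cint (R : realType) (u v : R -> R) (i j : nat) :
  fourier_coef u v (i%:Z - j%:Z) = ((2 * pi)^-1)%:C *
    cint (fun t => (u t +i* v t) * (cis (i%:R * t))^* * cis (j%:R * t)).
Proof.
apply: complex_ext; rewrite (ReM, ImM) /= mul0r (subr0, addr0); congr (_ * _);
  congr Defs.Rint; apply/funext => t; rewrite rmorphB/= mulrBl -!pmulrn cosB sinB; ring.
Qed.

Definition cdot (R : realType) (n : nat) (y z : 'cV[R[i]]_n) : R[i] :=
  \sum_(i < n) (y i ord0)^* * z i ord0.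

(** The squared Euclidean norm in real coordinates: without the square root, the estimates become
    polynomial inequalities. *)
Definition nrm2 (R : realType) (n : nat) (x : 'cV[R[i]]_n) : R :=
  \sum_(i < n) (complex.Re (x i ord0) ^+ 2 + complex.Im (x i ord0) ^+ 2).

(** The Toeplitz form is multiplication by the symbol between trigonometric polynomials; bounds on
    the matrix thus follow from pointwise bounds on the symbol. *)
Lemma cdot_toeplitz (R : realType) (u v : R -> R) (n : nat) (x y : 'cV[R[i]]_n) :
  bdd_meas (@Ipi R) u -> bdd_meas (@Ipi R) v ->
  cdot y (toeplitz u v n *m x) = ((2 * pi)^-1)%:C *
    cint (fun t => (u t +i* v t) * ((trigpoly y t)^* * trigpoly x t)).
Proof.
move=> bu bv.
have b1 (i j : nat) : cbdd (fun t => (u t +i* v t) * (cis (i%:R * t))^* * cis (j%:R * t)).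
  by apply: cbddM; [apply: cbddM; [by split|apply: cbddJ]|]; exact: cbdd_cis.
transitivity (((2 * pi)^-1)%:C * cint (fun t => \sum_(i < n) \sum_(j < n)
    ((y i ord0)^* * x j ord0) * ((u t +i* v t) * (cis (i%:R * t))^* * cis (j%:R * t)))).
  rewrite cint_sum; last first.
    by move=> i; apply: cbdd_sum => j; apply: cbddM => //; exact: cbdd_cst.
  rewrite mulr_sumr; apply: eq_bigr => i _.
  rewrite cint_sum; last by move=> j; apply: cbddM => //; exact: cbdd_cst.
  rewrite mxE !mulr_sumr; apply: eq_bigr => j _.
  by rewrite cintZl// mxE fourier_coef_cint; ring.
congr (_ * cint _); apply/funext => t.
rewrite /trigpoly raddf_sum/= mulr_suml mulr_sumr; apply: eq_bigr => i _.
rewrite !mulr_sumr; apply: eq_bigr => j _.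
by rewrite rmorphM/=; ring.
Qed.

Lemma sin_int_pi (R : realType) (k : int) : sin (k%:~R * pi : R) = 0.
Proof.
have sn (n : nat) : sin (n%:R * pi : R) = 0.
  elim: n => [|n IH]; first by rewrite mul0r sin0.
  by rewrite -natr1 mulrDl mul1r sinDpi IH oppr0.
by case: k => n; rewrite ?NegzE ?mulrNz ?mulNr ?sinN -pmulrn sn ?oppr0.
Qed.

(** The primitive [sin(kt)/k] vanishes at both endpoints. *)
Lemma Rint_cos (R : realType) (k : int) : k != 0 ->
  Defs.Rint (fun t : R => cos (k%:~R * t)) = 0.
Proof.
move=> k0; have k0' : (k%:~R : R) != 0 by rewrite intr_eq0.
have pi0 : - pi < pi :> R by rewrite gtrN ?pi_gt0.
set c : R := k%:~R in k0' *.
pose F (t : R) := c^-1 * sin (c * t).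
have dF (t : R) : is_derive t 1 F (cos (c * t)).
  have dc : is_derive t 1 (fun t : R => c *: (t : R^o)) c.
    by apply: is_derive_eq; rewrite /GRing.scale/= mulr1.
  have ds : is_derive t 1 (fun t : R => sin (c * t)) (cos (c * t) * c).
    by have := @is_derive1_comp _ sin (fun t : R => c * t) t _ _ (is_derive_sin _) dc.
  have := @is_deriveZ _ _ _ (fun t : R => sin (c * t) : R^o) c^-1 t 1 _ ds.
  by move=> H; apply: is_derive_eq H _; rewrite /GRing.scale/= mulrCA mulVf ?mulr1.
have cF : continuous F.
  by move=> t; apply: differentiable_continuous; apply/derivable1_diffP; case: (dF t).
rewrite /Defs.Rint /Rintegral /Ipi (@continuous_FTC2 _ _ F)//=.
- by rewrite /F mulrN sinN sin_int_pi oppr0 !mulr0 subr0.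
- apply: continuous_subspaceT => t; apply: continuous_comp; last exact: continuous_cos.
  exact: mulrl_continuous.
- split.
  + by move=> t _; case: (dF t).
  + exact: cvg_at_right_filter (cF _).
  + exact: cvg_at_left_filter (cF _).
- by move=> t _; rewrite derive1E; have [_ ->] := dF t.
Qed.

Lemma sqr_normcE (R : rcfType) (z : R[i]) :
  ComplexField.Normc.normc z ^+ 2 = complex.Re z ^+ 2 + complex.Im z ^+ 2.
Proof. by case: z => a b /=; rewrite sqr_sqrtr// addr_ge0// sqr_ge0. Qed.

Lemma sqr_vnorm (R : realType) (n : nat) (x : 'cV[R[i]]_n) : vnorm x ^+ 2 = nrm2 x.
Proof.
rewrite sqr_sqrtr; last by rewrite sumr_ge0// => i _; exact: sqr_ge0.
by apply: eq_bigr => i _; rewrite sqr_normcE.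
Qed.

Lemma nrm2_ge0 (R : realType) (n : nat) (x : 'cV[R[i]]_n) : 0 <= nrm2 x.
Proof. by rewrite -sqr_vnorm sqr_ge0. Qed.

Lemma nrm2_eq0 (R : realType) (n : nat) (x : 'cV[R[i]]_n) : nrm2 x = 0 -> x = 0.
Proof.
move=> /eqP; rewrite psumr_eq0 => [/allP x0|i _]; last by rewrite addr_ge0// sqr_ge0.
apply/matrixP => i j; rewrite ord1 mxE; have := x0 i (mem_index_enum _).
rewrite /= paddr_eq0 ?sqr_ge0// !sqrf_eq0 => /andP[/eqP xr /eqP xi].
exact: complex_ext.
Qed.

Lemma Re_sum (R : rcfType) (I : Type) (r : seq I) (F : I -> R[i]) :
  complex.Re (\sum_(i <- r) F i) = \sum_(i <- r) complex.Re (F i).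
Proof.
elim: r => [|i r IH]; first by rewrite !big_nil.
by rewrite !big_cons ReD IH.
Qed.

Lemma cdot_id (R : realType) (n : nat) (x : 'cV[R[i]]_n) : cdot x x = (nrm2 x)%:C.
Proof.
rewrite /cdot /nrm2 rmorph_sum/=; apply: eq_bigr => i _.
by apply: complex_ext; rewrite (ReM, ImM) ReJ ImJ /=; ring.
Qed.

(** Orthonormality of the exponentials, in matrix form. *)
Lemma toeplitz_one (R : realType) (n : nat) :
  toeplitz (fun=> 1 : R) (fun=> 0) n = 1%:M.
Proof.
apply/matrixP => i j; rewrite !mxE /fourier_coef.
set k : int := i%:Z - j%:Z.
have -> : (i == j) = (k == 0) by rewrite subr_eq0 eqz_nat.
have -> : (fun t : R => 1 * cos (k%:~R * t) + 0 * sin (k%:~R * t)) = (fun t => cos (k%:~R * t)).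
  by apply/funext => t; rewrite mul1r mul0r addr0.
have -> : (fun t : R => 0 * cos (k%:~R * t) - 1 * sin (k%:~R * t)) = (fun t => - sin (k%:~R * t)).
  by apply/funext => t; rewrite mul1r mul0r add0r.
have -> : Defs.Rint (fun t : R => - sin (k%:~R * t)) = 0.
  rewrite Rint_fold; last by apply: bdd_measN; exact: bdd_meas_sin.
  under eq_Rintegral do rewrite mulrN sinN opprK addNr.
  by rewrite Rintegral_cst ?mul0r.
have [->|k0] := eqVneq k 0; last by rewrite Rint_cos// !mulr0.
have -> : Defs.Rint (fun t : R => cos (0%:~R * t)) = 2 * pi.
  have -> : (fun t : R => cos (0%:~R * t)) = fun=> 1 by apply/funext => t; rewrite mul0r cos0.
  rewrite /Defs.Rint Rintegral_cst; last exact: measurable_Ipi.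
  rewrite /Ipi /= lebesgue_measure_itv/= lte_fin gtrN ?pi_gt0//= mul1r; ring.
by rewrite mulr0 mulVf// mulf_neq0 ?pnatr_eq0// gt_eqF// pi_gt0.
Qed.

Lemma Re_cint (R : realType) (c : R) (h : R -> R[i]) :
  complex.Re (c%:C * cint h) = c * Defs.Rint (fun t => complex.Re (h t)).
Proof. by rewrite ReM /= mul0r subr0. Qed.

(** This is the quadratic form of the symbol 1, whose Toeplitz matrix is the identity. *)
Lemma parseval (R : realType) (n : nat) (x : 'cV[R[i]]_n) :
  (2 * pi)^-1 * Defs.Rint (fun t => complex.Re (trigpoly x t) ^+ 2 + complex.Im (trigpoly x t) ^+ 2) = nrm2 x.
Proof.
have := cdot_toeplitz x x (bdd_meas_cst (@Ipi R) 1) (bdd_meas_cst (@Ipi R) 0).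
rewrite toeplitz_one mul1mx cdot_id => /(congr1 (@complex.Re R)).
rewrite Re_cint /= => ->; congr (_ * Defs.Rint _); apply/funext => t.
by rewrite !ReM !ImM ReJ ImJ /=; ring.
Qed.

Lemma bdd_meas_trigpoly (R : realType) (n : nat) (x : 'cV[R[i]]_n) :
  bdd_meas (@Ipi R) (fun t => complex.Re (trigpoly x t) ^+ 2 + complex.Im (trigpoly x t) ^+ 2).
Proof.
by have [b1 b2] := cbdd_trigpoly x; apply: bdd_measD; exact: bdd_measX.
Qed.

Lemma toeplitz_norm_le (R : realType) (u v : R -> R) (M : R) (n : nat) (x : 'cV[R[i]]_n) :
  bdd_meas (@Ipi R) u -> bdd_meas (@Ipi R) v ->
  (forall t, @Ipi R t -> absf u v t <= M) ->
  nrm2 (toeplitz u v n *m x) <= M ^+ 2 * nrm2 x.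
Proof.
move=> bu bv uvM; set y := toeplitz u v n *m x.
have := cdot_toeplitz x y bu bv; rewrite -/y cdot_id => /(congr1 (@complex.Re R)).
rewrite Re_cint /= => E.
have tp0 : 0 <= (2 * pi)^-1 :> R by rewrite invr_ge0 mulr_ge0// pi_ge0.
have bx := bdd_meas_trigpoly x; have by_ := bdd_meas_trigpoly y.
(* [2 Re (f conj(q) p) <= |f|^2 |p|^2 + |q|^2] under the integral, tested at [y = A_n(f) x] *)
suff : nrm2 y <= 1 / 2 * (M ^+ 2 * nrm2 x + nrm2 y) by lra.
rewrite {1}E -(parseval x) -[X in _ + X](parseval y).
rewrite mulrCA -mulrDr [leRHS]mulrCA ler_wpM2l//.
have bMx := bdd_measM (bdd_meas_cst _ (M ^+ 2)) bx.
rewrite -RintZl// -RintD// -RintZl; last exact: bdd_measD.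
have [cx1 cx2] := cbdd_trigpoly x; have [cy1 cy2] := cbdd_trigpoly y.
apply: le_Rint.
- have : cbdd (fun t => (u t +i* v t) * ((trigpoly y t)^* * trigpoly x t)).
    by apply: cbddM => //; apply: cbddM; [apply: cbddJ|]; exact: cbdd_trigpoly.
  by case.
- by apply: bdd_measM; [exact: bdd_meas_cst|exact: bdd_measD].
move=> t It; rewrite !ReM !ImM ReJ ImJ /=.
have : u t ^+ 2 + v t ^+ 2 <= M ^+ 2.
  by rewrite -sqr_absf lerXn2r ?nnegrE ?absf_ge0// ?uvM// (le_trans (absf_ge0 u v t))// uvM.
move: (u t) (v t) => a b.
move: (complex.Re (trigpoly x t)) (complex.Im (trigpoly x t))
  (complex.Re (trigpoly y t)) (complex.Im (trigpoly y t)).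
move=> p q r s abM.
(* [h1] bounds [|f p|^2] by [M^2 |p|^2]; [h2] and [h3] are the squared real and imaginary parts of
   [f p - q]. *)
have h1 : 0 <= (M ^+ 2 - (a ^+ 2 + b ^+ 2)) * (p ^+ 2 + q ^+ 2).
  by rewrite mulr_ge0 ?subr_ge0// addr_ge0 ?sqr_ge0.
have h2 := sqr_ge0 (a * p - b * q - r); have h3 := sqr_ge0 (a * q + b * p - s).
by nra.
Qed.

(** Coercivity: [delta |x|^2 <= Re <x, y>] for [y = A_n(g) x], by Parseval. Combined with [2 delta
    Re <x, y> <= delta^2 |x|^2 + |y|^2], this gives the bound. *)
Lemma toeplitz_norm_ge (R : realType) (g : R -> R) (delta : R) (n : nat) (x : 'cV[R[i]]_n) :
  bdd_meas (@Ipi R) g -> 0 < delta -> (forall t, @Ipi R t -> delta <= g t) ->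
  delta ^+ 2 * nrm2 x <= nrm2 (toeplitz g (fun=> 0) n *m x).
Proof.
move=> bg d0 gd; set y := toeplitz g (fun=> 0) n *m x.
have := cdot_toeplitz x x bg (bdd_meas_cst (@Ipi R) 0); rewrite -/y => /(congr1 (@complex.Re R)).
rewrite Re_cint /= => E.
have tp0 : 0 <= (2 * pi)^-1 :> R by rewrite invr_ge0 mulr_ge0// pi_ge0.
have bx := bdd_meas_trigpoly x.
have lb : delta * nrm2 x <= complex.Re (cdot x y).
  rewrite E -(parseval x) mulrCA ler_wpM2l// -RintZl//; apply: le_Rint.
  - by apply: bdd_measM => //; exact: bdd_meas_cst.
  - have : cbdd (fun t => (g t +i* 0) * ((trigpoly x t)^* * trigpoly x t)).
      apply: cbddM; last by apply: cbddM; [apply: cbddJ|]; exact: cbdd_trigpoly.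
      by split => //; exact: bdd_meas_cst.
    by case.
  - move=> t It; rewrite !ReM !ImM ReJ ImJ /=.
    move: (complex.Re (trigpoly x t)) (complex.Im (trigpoly x t)) => p q.
    have -> : g t * (p * p - - q * q) - 0 * (p * q + - q * p) = g t * (p ^+ 2 + q ^+ 2) by ring.
    by rewrite ler_wpM2r ?gd// addr_ge0 ?sqr_ge0.
have ub : complex.Re (cdot x y) *+ 2 * delta <= delta ^+ 2 * nrm2 x + nrm2 y.
  rewrite /cdot Re_sum /nrm2 mulr_sumr -big_split/= -sumrMnl mulr_suml.
  apply: ler_sum => i _; rewrite ReM ReJ ImJ.
  move: (complex.Re (x i ord0)) (complex.Im (x i ord0))
    (complex.Re (y i ord0)) (complex.Im (y i ord0)) => a b c d.
  have h1 := sqr_ge0 (delta * a - c); have h2 := sqr_ge0 (delta * b - d).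
  by rewrite mulr2n; lra.
have : delta * (delta * nrm2 x) <= delta * complex.Re (cdot x y) by rewrite ler_wpM2l// ltW.
by nra.
Qed.

(** * Spectral norms and eigenvalues *)

(** The parallelogram law with the term [|x + y|^2] dropped. *)
Lemma nrm2B (R : realType) (n : nat) (x y : 'cV[R[i]]_n) :
  nrm2 (x - y) <= 2 * nrm2 x + 2 * nrm2 y.
Proof.
rewrite /nrm2 !mulr_sumr -big_split/=; apply: ler_sum => i _.
rewrite !mxE; case: (x i ord0) (y i ord0) => [a b] [c d] /=.
have h1 := sqr_ge0 (a + c); have h2 := sqr_ge0 (b + d).
by lra.
Qed.

Lemma nrm2Z (R : realType) (n : nat) (a : R[i]) (x : 'cV[R[i]]_n) :
  nrm2 (a *: x) = (complex.Re a ^+ 2 + complex.Im a ^+ 2) * nrm2 x.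
Proof.
rewrite /nrm2 mulr_sumr; apply: eq_bigr => i _; rewrite mxE ReM ImM; ring.
Qed.

Lemma exchange_mulmxE (R : realType) (m n : nat) (B : 'M[R[i]]_(n, m)) (i : 'I_n) (j : 'I_m) :
  (exchange R n *m B) i j = B (rev_ord i) j.
Proof.
rewrite mxE (bigD1 (rev_ord i))//= !mxE big1 ?addr0 => [|k ki].
  have -> : (i + rev_ord i)%N == n.-1 by case: i => i /= ltin; apply/eqP; lia.
  by rewrite mul1r.
rewrite mxE; have -> : (i + k)%N == n.-1 = false; last by rewrite mul0r.
apply: contra_neqF ki => /eqP ik; apply/val_inj => /=.
by case: i k ik => [i lti] [k ltk] /= ik; lia.
Qed.

Lemma nrm2_exchange (R : realType) (n : nat) (x : 'cV[R[i]]_n) :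
  nrm2 (exchange R n *m x) = nrm2 x.
Proof.
rewrite [RHS](reindex_inj rev_ord_inj)/=.
by apply: eq_bigr => i _; rewrite exchange_mulmxE.
Qed.

Lemma specnorm_le (R : realType) (n : nat) (A : 'M[R[i]]_n) (C : R) :
  (forall x : 'cV[R[i]]_n, nrm2 (A *m x) <= C * nrm2 x) ->
  0 <= specnorm A <= Num.sqrt C.
Proof.
move=> AC; set S := [set vnorm (A *m x) | x in [set x : 'cV[R[i]]_n | vnorm x <= 1]].
have v0 : vnorm (0 : 'cV[R[i]]_n) = 0.
  by apply/eqP; rewrite -sqrf_eq0 sqr_vnorm /nrm2 big1// => i _; rewrite mxE/= !expr0n/= addr0.
have S0 : S 0 by exists 0; rewrite /= ?v0 ?ler01// mulmx0 v0.
have ubS : ubound S (Num.sqrt C).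
  move=> _ [x /= x1 <-].
  have nx1 : nrm2 x <= 1 by rewrite -sqr_vnorm expr_le1// sqrtr_ge0.
  have [C0|C0] := leP 0 C.
    rewrite -(@ler_pXn2r _ 2)// ?nnegrE ?sqrtr_ge0// sqr_vnorm sqr_sqrtr//.
    by rewrite (le_trans (AC x))// ler_piMr.
  (* For [C < 0] the hypothesis forces [A x] to have norm 0. *)
  have : nrm2 (A *m x) <= 0.
    by rewrite (le_trans (AC x))// mulr_le0_ge0// ?nrm2_ge0// ltW.
  rewrite -sqr_vnorm => h; have /eqP : vnorm (A *m x) ^+ 2 = 0.
    by apply/eqP; rewrite eq_le h sqr_ge0.
  by rewrite sqrf_eq0 => /eqP ->; exact: sqrtr_ge0.
apply/andP; split; first by apply: ub_le_sup => //; exists (Num.sqrt C).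
by apply: ge_sup => //; exists 0.
Qed.

Lemma toeplitz_unit (R : realType) (g : R -> R) (delta : R) (n : nat) :
  bdd_meas (@Ipi R) g -> 0 < delta -> (forall t, @Ipi R t -> delta <= g t) ->
  toeplitz g (fun=> 0) n \in unitmx.
Proof.
move=> bg d0 gd; rewrite unitmxE unitfE -det_tr; apply/det0P => -[w w0].
move=> /(congr1 trmx); rewrite trmx_mul trmxK trmx0 => Tw.
have := toeplitz_norm_ge w^T bg d0 gd; rewrite Tw.
have -> : nrm2 (0 : 'cV[R[i]]_n) = 0 by rewrite /nrm2 big1// => i _; rewrite mxE/= !expr0n/= addr0.
rewrite pmulr_rle0 ?exprn_gt0// => h.
have /nrm2_eq0 : nrm2 w^T = 0 by apply/eqP; rewrite eq_le h nrm2_ge0.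
by move=> /(congr1 trmx); rewrite trmxK trmx0 => /eqP; rewrite (negbTE w0).
Qed.

Lemma nrm2_invmx_toeplitz (R : realType) (g : R -> R) (delta : R) (n : nat) (x : 'cV[R[i]]_n) :
  bdd_meas (@Ipi R) g -> 0 < delta -> (forall t, @Ipi R t -> delta <= g t) ->
  nrm2 (invmx (toeplitz g (fun=> 0) n) *m x) <= delta ^- 2 * nrm2 x.
Proof.
move=> bg d0 gd; have := toeplitz_norm_ge (invmx (toeplitz g (fun=> 0) n) *m x) bg d0 gd.
rewrite mulmxA mulmxV ?mul1mx; last exact: toeplitz_unit d0 gd.
by move=> h; rewrite ler_pdivlMl// exprn_gt0.
Qed.

(** The factors obey [|A_M^-1| <= 1/delta], [|A_n(f)| <= M] and [|A_n(f~)| <= 1], and [Y_n] is an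
    isometry. The resulting constant does not depend on [n]. *)
Lemma Emat_norm (R : realType) (u v : R -> R) (delta M : R) (n : nat) (x : 'cV[R[i]]_n) :
  measurable_fun (@Ipi R) u -> measurable_fun (@Ipi R) v -> 0 < delta ->
  (forall t, @Ipi R t -> delta <= absf u v t <= M) ->
  nrm2 (Emat u v n *m x) <= (2 * (delta ^- 2 * M ^+ 2) + 2) * nrm2 x.
Proof.
move=> mu mv d0 uvb; have mI := @measurable_Ipi R.
have uvM t : @Ipi R t -> absf u v t <= M by move=> /uvb /andP[].
have uvd t : @Ipi R t -> delta <= absf u v t by move=> /uvb /andP[].
have uv0 t : @Ipi R t -> 0 < absf u v t by move=> /uvd; exact: lt_le_trans.
have [bu bv] := bdd_meas_symbol mu mv uvM.
have ba : bdd_meas (@Ipi R) (absf u v).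
  split; first exact: measurable_absf.
  by exists M => t It; rewrite ger0_norm ?absf_ge0// uvM.
have ab1 t : @Ipi R t -> absf (tilde_re u v) (tilde_im u v) t <= 1.
  by move=> It; rewrite absf_tilde// uv0.
have [bu' bv'] : bdd_meas (@Ipi R) (tilde_re u v) /\ bdd_meas (@Ipi R) (tilde_im u v).
  by apply: bdd_meas_symbol ab1; exact: measurable_div_absf.
rewrite /Emat mulmxBl -!mulmxA (le_trans (nrm2B _ _))//.
have -> : (2 * (delta ^- 2 * M ^+ 2) + 2) * nrm2 x =
    2 * (delta ^- 2 * (M ^+ 2 * nrm2 x)) + 2 * nrm2 x by ring.
rewrite lerD// ler_wpM2l//.
  apply: le_trans (nrm2_invmx_toeplitz _ ba d0 uvd) _.
  rewrite ler_wpM2l ?invr_ge0 ?exprn_ge0 ?(ltW d0)// nrm2_exchange.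
  exact: toeplitz_norm_le.
rewrite nrm2_exchange (le_trans (toeplitz_norm_le _ bu' bv' ab1))// expr1n mul1r//.
Qed.

(** A real symmetric matrix is Hermitian, so [<x, B x> = a |x|^2] is real and [a] with it;
    contractivity gives [|a| <= 1]. *)
Lemma eigenvalue_real_symmetric (R : realType) (n : nat) (B : 'M[R[i]]_n) (a : R[i]) :
  B^T = B -> (forall i j, complex.Im (B i j) = 0) ->
  (forall x : 'cV[R[i]]_n, nrm2 (B *m x) <= nrm2 x) ->
  eigenvalue B a -> -1 <= a <= 1.
Proof.
move=> Bsym Breal Ble /eigenvalueP[w /(congr1 trmx)].
(* [eigenvalue] refers to row vectors; symmetry turns one into a column eigenvector. *)
rewrite trmx_mul Bsym linearZ/=; set x := w^T => Bx w0.
have nx : 0 < nrm2 x.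
  rewrite lt_neqAle nrm2_ge0 andbT eq_sym; apply/eqP => /nrm2_eq0.
  by move=> /(congr1 trmx); rewrite trmxK trmx0 => /eqP; rewrite (negbTE w0).
clearbody x.
have a1 : complex.Re a ^+ 2 + complex.Im a ^+ 2 <= 1.
  by have := Ble x; rewrite Bx nrm2Z -[leRHS]mul1r ler_pM2r.
have BJ i j : (B i j)^* = B i j.
  by apply: complex_ext; rewrite (ReJ, ImJ)// Breal oppr0.
have dotJ : (cdot x (B *m x))^* = cdot x (B *m x).
  rewrite /cdot rmorph_sum/=.
  under eq_bigr => i _ do rewrite rmorphM/= conjcK mxE rmorph_sum/= mulr_sumr.
  under [RHS]eq_bigr => i _ do rewrite mxE mulr_sumr.
  rewrite exchange_big/=; apply: eq_bigr => i _; apply: eq_bigr => j _.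
  by rewrite rmorphM/= BJ -{1}Bsym mxE; ring.
have dotE : cdot x (B *m x) = a * (nrm2 x)%:C.
  rewrite Bx -cdot_id /cdot mulr_sumr; apply: eq_bigr => i _.
  by rewrite mxE mulrCA.
have /eqP : complex.Im a * nrm2 x = 0.
  have := congr1 (@complex.Im R) dotJ.
  by rewrite ImJ dotE ImM /= mulr0 add0r => h; lra.
rewrite mulf_eq0 (gt_eqF nx) orbF => /eqP a0.
rewrite a0 expr0n addr0 /= in a1.
(* The order on [R[i]] requires equal imaginary parts, so that [a] is real is part of the claim. *)
rewrite !lecE /= a0 !oppr0 eqxx /= -ler_norml.
by rewrite -(@ler_pXn2r _ 2)// ?nnegrE// real_normK ?num_real// expr1n.
Qed.

(** Reversing the rows gives a Hankel matrix: the entries depend only on [n - 1 - i - j], whence the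
    symmetry. *)
Lemma exchange_toeplitz_eigenvalue (R : realType) (u v : R -> R) (n : nat) (a : R[i]) :
  bdd_meas (@Ipi R) u -> bdd_meas (@Ipi R) v ->
  (forall t, @Ipi R t -> absf u v t <= 1) ->
  (forall k : int, complex.Im (fourier_coef u v k) = 0) ->
  eigenvalue (exchange R n *m toeplitz u v n) a -> -1 <= a <= 1.
Proof.
move=> bu bv uv1 coef0; apply: eigenvalue_real_symmetric.
- apply/matrixP => i j; rewrite mxE !exchange_mulmxE !mxE; congr fourier_coef => /=.
  by case: i j => [i lti] [j ltj] /=; lia.
- by move=> i j; rewrite exchange_mulmxE mxE coef0.
- move=> x; rewrite -mulmxA nrm2_exchange.
  by have := toeplitz_norm_le x bu bv uv1; rewrite expr1n mul1r.
Qed.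

(* Reduction to a bounded symbol, uniform bound and spectrum *)
Local Close Scope complex_scope.

Theorem theorem3p5 (R : realType) (u v : R -> R) (delta : R) :
  (* f = u + i v is in L^oo([-pi,pi]) *)
  measurable_fun (@Ipi R) u -> measurable_fun (@Ipi R) v ->
  (exists M : R, {ae @lebesgue_measure R, forall t, @Ipi R t -> absf u v t <= M}) ->
  (* f has real Fourier coefficients *)
  (forall k : int, Im (fourier_coef u v k) = 0) ->
  (* delta <= |f(t)| on [-pi,pi] *)
  0 < delta -> (forall t, @Ipi R t -> delta <= absf u v t) ->
  (* ||E_n||_2 = o(n) *)
  ((fun n : nat => specnorm (Emat u v n) / n%:R) @ \oo --> (0 : R)) /\
  (* eigenvalues of Y_n A_n(f~) lie in [-1,1] *)
  (forall (n : nat) (a : R[i]),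
     eigenvalue (@exchange R n *m toeplitz (tilde_re u v) (tilde_im u v) n) a ->
     -1 <= a <= 1).
Proof.
move=> mu mv uvM coef0 d0 duv.
have [u' [v' [M [[mu' mv'] uv' [M0 uvb]]]]] := ae_bounded_symbol mu mv uvM d0 duv.
have uv0 t : @Ipi R t -> 0 < absf u v t by move=> /duv; exact: lt_le_trans.
have uv0' t : @Ipi R t -> 0 < absf u' v' t.
  by move=> /uvb /andP[+ _]; exact: lt_le_trans.
have mI := @measurable_Ipi R.
have [mtu mtv] : measurable_fun (@Ipi R) (tilde_re u v) /\ measurable_fun (@Ipi R) (tilde_im u v).
  by split; exact: measurable_div_absf.
have [mtu' mtv'] : measurable_fun (@Ipi R) (tilde_re u' v') /\ measurable_fun (@Ipi R) (tilde_im u' v').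
  by split; exact: measurable_div_absf.
have cE := fourier_coef_ae_eq mu mv mu' mv' uv'.
have ctE : forall k, fourier_coef (tilde_re u v) (tilde_im u v) k =
                     fourier_coef (tilde_re u' v') (tilde_im u' v') k.
  apply: fourier_coef_ae_eq => //; move: uv'; apply: filterS.
    exact: (ae_filter_ringOfSetsType lebesgue_measure).
  by move=> t h It; have [ut vt] := h It; rewrite /tilde_re /tilde_im /absf ut vt.
have caE : forall k, fourier_coef (absf u v) (fun=> 0) k = fourier_coef (absf u' v') (fun=> 0) k.
  apply: fourier_coef_ae_eq => //; try exact: measurable_absf.
  move: uv'; apply: filterS; first exact: (ae_filter_ringOfSetsType lebesgue_measure).
  by move=> t h It; have [ut vt] := h It; rewrite /absf ut vt.
have toeplitzE (f g f' g' : R -> R) n : fourier_coef f g =1 fourier_coef f' g' ->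
    toeplitz f g n = toeplitz f' g' n.
  by move=> fg; apply/matrixP => i j; rewrite !mxE fg.
(* All three Toeplitz matrices depend on Fourier coefficients alone, so [E_n] is unchanged by the
   modification. *)
have EE n : Emat u v n = Emat u' v' n.
  by rewrite /Emat (toeplitzE _ _ _ _ n cE) (toeplitzE _ _ _ _ n ctE) (toeplitzE _ _ _ _ n caE).
have ab1 t : @Ipi R t -> absf (tilde_re u' v') (tilde_im u' v') t <= 1.
  by move=> It; rewrite absf_tilde// uv0'.
have coef0' k : complex.Im (fourier_coef u' v' k) = 0.
  (* The hypothesis speaks of the imaginary part as an element of [R[i]]; [complexIm] links it to
     the real-valued [complex.Im]. *)
  by rewrite -cE; apply: complexI; rewrite complexIm coef0.
split; last first.
  move=> n a; rewrite (toeplitzE _ _ _ _ n ctE).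
  have [bu' bv'] := bdd_meas_symbol mtu' mtv' ab1.
  apply: exchange_toeplitz_eigenvalue => // k.
  exact: tilde_real_coef d0 uvb coef0'.
pose C := Num.sqrt (2 * (delta ^- 2 * M ^+ 2) + 2).
apply: (@squeeze_cvgr _ _ _ _ (fun=> 0) (fun n => C * n%:R^-1)); first last.
- rewrite -[X in _ --> X](mulr0 C); apply: cvgM; first exact: cvg_cst.
  apply/gtr0_cvgV0; last exact: cvgr_idn.
  by exists 1%N => // n /= n0; rewrite ltr0n.
- exact: cvg_cst.
(* The comparison holds for every [n]: at [n = 0] both sides are 0, since the inverse of 0 is 0. *)
apply: nearW => n; have /andP[E0 EC] : 0 <= specnorm (Emat u v n) <= C.
  by apply: specnorm_le => x; rewrite EE; exact: Emat_norm d0 uvb.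
by rewrite divr_ge0//= ler_wpM2r// invr_ge0.
Qed.
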